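(* Let $\alpha_L$ be the Lüroth partition, given by $t_n=1/n$, $n\ge1$. Then $\mathcal M_{\alpha_L}$ is the union of eight disjoint closed subintervals of equal length. Furthermore, for any interior point $M$ of $\mathcal M_{\alpha_L}$ there exist uncountably many $\varepsilon\in\{0,1\}^{\mathbb N}$ such that $M_\varepsilon=M$.
   Context: A partition $\alpha\in\mathcal P$ is given by a strictly decreasing sequence $(t_n)_{n\ge1}\subseteq(0,1]$ with $t_1=1$ and $t_n\to0$. Put $a_n=t_n-t_{n+1}$. For $\varepsilon=(\varepsilon_n)\in\{0,1\}^{\mathbb N}$ and $z\in(0,1]$ let $F_\varepsilon(z)=\sum_{n:\,a_n/t_{n+1-\varepsilon_n}<z}a_n+\sum_{n:\,a_n/t_{n+1-\varepsilon_n}\ge z}t_{n+1-\varepsilon_n}z$, let $M_\varepsilon=\int_0^1(1-F_\varepsilon(z))\,dz$, and $\mathcal M_\alpha=\{M_\varepsilon:\varepsilon\in\{0,1\}^{\mathbb N}\}$. *)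

(* Defs.v *)
From mathcomp Require Import all_boot all_order all_algebra.
From mathcomp Require Import all_classical all_reals all_analysis.

Set Implicit Arguments.
Unset Strict Implicit.
Unset Printing Implicit Defensive.

Import Order.TTheory GRing.Theory Num.Theory.
Import numFieldNormedType.Exports.

Local Open Scope classical_set_scope.
Local Open Scope ring_scope.

(* All sequences are indexed from 0: the mathematical index n >= 1 is
   represented by n - 1.  The index n + 1 - e_n keeps its form under this
   shift, and since e n <= 1 the subtraction n.+1 - e n is never truncated. *)
Record unit_partition (R : realType) := UnitPartition {
  t_ :> nat -> R ;
  t_itv : forall n, 0 < t_ n <= 1 ;
  t_first : t_ 0%N = 1 ;
  t_decr : decreasing_seq t_ ;
  t_cvg0 : t_ @ \oo --> 0
}.

Section partition_approximation.
Variables (R : realType) (t : unit_partition R).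
Implicit Types (e : nat -> bool) (z : R).

Definition a_ (n : nat) : R := t n - t n.+1.

(* Both series have nonnegative terms bounded by a_ n when 0 < z, so the
   limits below exist on ]0, 1]. *)
Definition F_ e z : R :=
  \big[+%R/0]_(0 <= n <oo | a_ n / t (n.+1 - e n)%N < z) a_ n
  + \big[+%R/0]_(0 <= n <oo | z <= a_ n / t (n.+1 - e n)%N) (t (n.+1 - e n)%N * z).

Definition M_ e : R :=
  \int[@lebesgue_measure R]_(z in `]0, 1]) (1 - F_ e z).

Definition Mset : set R := range M_.

End partition_approximation.

Section luroth.
Variable R : realType.

Definition luroth_seq (n : nat) : R := n.+1%:R^-1.

Fact luroth_itv n : 0 < luroth_seq n <= 1.
Proof. by rewrite /luroth_seq invr_gt0 ltr0n /= invf_le1 ?ltr0n// ler1n. Qed.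

Fact luroth_first : luroth_seq 0%N = 1.
Proof. by rewrite /luroth_seq invr1. Qed.

Fact luroth_decr : decreasing_seq luroth_seq.
Proof. by move=> m n; rewrite /luroth_seq lef_pV2 ?posrE ?ltr0n// ler_nat ltnS. Qed.

Fact luroth_cvg0 : luroth_seq @ \oo --> 0.
Proof. exact: cvg_harmonic. Qed.

Definition luroth : unit_partition R :=
  UnitPartition luroth_itv luroth_first luroth_decr luroth_cvg0.

End luroth.

(* Main.v *)
(* Integrating term by term, M_e = sum_n a_n^2 / (2 t_{n+1-e_n}).  For the Luroth
   partition (indexing from 0) this is a constant plus half the subsum, over the
   n with e_n = 0, of the series d_n = 1/((n+1)(n+2))^2.  Telescoping bounds on
   the tails r_n = sum_{k >= n} d_k give r_3 <= 1/180 < d_2 = 1/144, so the first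
   three digits separate eight intervals, and d_n < r_{n+1} for n >= 3, so that
   by Kakeya's criterion the subsums of (d_n)_{n >= 3} fill [0, r_3].
   For multiplicity, keep the remainder y_n of a greedy expansion strictly inside
   ]0, r_n[.  A digit is free when d_n < y_n < r_{n+1}.  Since d_n < r_{n+2}
   eventually, forced digits can only repeat, and a constant run of forced digits
   would drive the remainder to an endpoint; so free digits occur infinitely often
   and can be used to diagonalize against any sequence of expansions. *)

Require Import Defs.
From mathcomp Require Import all_boot all_order all_algebra.
From mathcomp Require Import all_classical all_reals all_analysis.
From mathcomp Require Import measurable_realfun ring lra.

Import Order.TTheory GRing.Theory Num.Theory.
Import numFieldNormedType.Exports.

Local Open Scope classical_set_scope.
Local Open Scope ring_scope.

(** * Subsum expansions diagonalized against a sequence of expansions *)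

Section subsum_expansion.
Variables (R : realType) (d r : nat -> R) (E : nat -> nat -> bool) (x : R).
Hypothesis d_gt0 : forall n, 0 < d n.
Hypothesis r_rec : forall n, r n = d n + r n.+1.
Hypothesis d_lt : forall n, d n < r n.+1.
Hypothesis d_lt2 : \forall n \near \oo, d n < r n.+2.
Hypothesis r_cvg0 : r @ \oo --> 0.
Hypothesis x_itv : 0 < x < r 0.

(* The state holds the remainder still to be represented and the number of
   free choices made so far; the [i]-th free choice is made against [E i]. *)
Definition greedy_step (n : nat) (s : R * nat) : bool * (R * nat) :=
  let free := (d n < s.1) && (s.1 < r n.+1) in
  let b := if free then ~~ E s.2 n else d n < s.1 in
  (b, (s.1 - b%:R * d n, (s.2 + free)%N)).

Fixpoint greedy_state (n : nat) : R * nat :=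
  if n is m.+1 then (greedy_step m (greedy_state m)).2 else (x, 0%N).

Definition greedy (n : nat) : bool := (greedy_step n (greedy_state n)).1.

Let y n := (greedy_state n).1.
Let j n := (greedy_state n).2.
Let free n := (d n < y n) && (y n < r n.+1).

Let greedyE n : greedy n = if free n then ~~ E (j n) n else d n < y n.
Proof. by []. Qed.

Let yS n : y n.+1 = y n - (greedy n)%:R * d n. Proof. by []. Qed.

Let jS n : j n.+1 = (j n + free n)%N. Proof. by []. Qed.

(** If [y n <= d n], digit 0 is safe because [d n < r n.+1]; if [r n.+1 <= y n], digit 1 is safe;
    strictly in between both are. *)
Let y_itv n : 0 < y n < r n.
Proof.
elim: n => [//|n /andP[y0 yr]].
rewrite yS greedyE /free; have := d_lt n; have := d_gt0 n; have := r_rec n.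
by have [dy|yd] := ltP (d n) (y n); have [yr'|ry] := ltP (y n) (r n.+1);
  try case: (E _ _); rewrite /= ?mul1r ?mul0r ?subr0 => *; apply/andP; split; lra.
Qed.

Lemma greedy_remainder n :
  0 < x - \sum_(0 <= k < n) (greedy k)%:R * d k < r n.
Proof.
suff <- : y n = x - \sum_(0 <= k < n) (greedy k)%:R * d k by exact: y_itv.
elim: n => [|n IH]; first by rewrite big_nil subr0.
by rewrite big_nat_recr//= yS IH opprD addrA.
Qed.

Let free_infinite N : exists2 n, (N <= n)%N & free n.
Proof.
apply: contrapT => nfree.
have {}nfree n : (N <= n)%N -> free n = false.
  by move=> Nn; apply/negP => fn; apply: nfree; exists n.
have [K _ Kd] := d_lt2.
pose m := maxn N K.
have [mN mK] : (N <= m /\ K <= m)%N by rewrite leq_maxl leq_maxr.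
(* A forced 1 means [r n.+1 <= y n], so [y n.+1 >= d n.+1 + r n.+2 - d n > d n.+1]. A forced 0 gives
   [y n.+1 = y n <= d n < r n.+2], and as digit [n.+1] is not free, [y n.+1 <= d n.+1]. *)
have const k : greedy (m + k) = greedy m.
  elim: k => [|k <-]; first by rewrite addn0.
  set n := (m + k)%N; rewrite addnS -/n.
  have Nn : (N <= n)%N by rewrite (leq_trans mN)// leq_addr.
  have dn2 : d n < r n.+2 by apply: Kd => /=; rewrite (leq_trans mK)// leq_addr.
  have fn := nfree _ Nn; have fn1 := nfree _ (leqW Nn).
  have gn : greedy n = (d n < y n) by rewrite greedyE fn.
  rewrite gn greedyE fn1; move: fn1 fn; rewrite /free yS gn.
  have := d_lt n; have := d_gt0 n; have := r_rec n.+1.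
  by have [dy|yd] := ltP (d n) (y n); have [yr'|ry] := ltP (y n) (r n.+1);
    rewrite /= ?mul1r ?mul0r ?subr0;
    have [dy1|yd1] := ltP (d n.+1) _; have [yr1|ry1] := ltP _ (r n.+2) => //= *;
    exfalso; lra.
have [gm|gm] := boolP (greedy m).
(* A run of ones freezes [r - y] at a positive value; once [r] drops below it, [y] would be
   negative. *)
- have ry k : r (m + k)%N - y (m + k)%N = r m - y m.
    elim: k => [|k <-]; first by rewrite addn0.
    by rewrite addnS yS const gm mul1r (r_rec (m + k)); ring.
  have [_ c0] := andP (y_itv m).
  have /cvgrPdist_lt/(_ (r m - y m)) := r_cvg0.
  rewrite subr_gt0 => /(_ c0)[k _ rk].
  have /rk : (k <= (m + k))%N by rewrite leq_addl.
  rewrite /= sub0r normrN -(ry k); move: (y_itv (m + k)) => /andP[y0 yr].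
  have fk : free (m + k) = false by rewrite nfree// (leq_trans mN)// leq_addr.
  have := const k; rewrite gm greedyE fk => dy; move: fk.
  rewrite /free dy /= => /negbT; rewrite -leNgt => ry'.
  rewrite gtr0_norm; last exact: lt_trans yr.
  by have := r_rec (m + k); have := d_lt (m + k); lra.
(* A run of zeros freezes [y], yet keeps it below [r], which tends to 0. *)
- have yc k : y (m + k)%N = y m.
    elim: k => [|k <-]; first by rewrite addn0.
    by rewrite addnS yS const (negbTE gm) mul0r subr0.
  have [c0 _] := andP (y_itv m).
  have /cvgrPdist_lt/(_ _ c0) [k _ rk] := r_cvg0.
  have /rk : (k <= (m + k).+1)%N by rewrite leqW// leq_addl.
  have := const k; rewrite greedyE nfree ?(leq_trans mN)// ?leq_addr//.
  rewrite (negbTE gm) yc /= => /negbT; rewrite -leNgt => yd.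
  have := d_lt (m + k); have := d_gt0 (m + k) => d0 dr.
  by rewrite sub0r normrN gtr0_norm; lra.
Qed.

Let j_nondecr m n : (m <= n)%N -> (j m <= j n)%N.
Proof.
move=> /subnK <-; elim: (n - m)%N => [//|k IH].
by rewrite addSn jS (leq_trans IH)// leq_addr.
Qed.

Let j_unbounded i : exists n, (i < j n)%N.
Proof.
elim: i => [|i [n ijn]].
  by have [n _ fn] := free_infinite 0; exists n.+1; rewrite jS fn addn1.
have [k nk fk] := free_infinite n.
by exists k.+1; rewrite jS fk addn1 ltnS (leq_trans ijn)// j_nondecr.
Qed.

Lemma greedy_neq i : greedy <> E i.
Proof.
move=> eqE; case: (ex_minnP (j_unbounded i)) => -[|n]; first by [].
(* [n.+1] is the first index whose count exceeds [i], so digit [n] is the free choice made against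
   [E i]. *)
rewrite jS => ijn min_n.
have jn : (j n <= i)%N by rewrite leqNgt; apply/negP => /min_n; rewrite ltnn.
have fn : free n by move: ijn; case: (free n) => //; rewrite addn0 ltnNge jn.
have jni : j n = i by apply/eqP; rewrite eqn_leq jn; move: ijn; rewrite fn addn1.
have := greedyE n; rewrite fn jni eqE; by case: (E i n).
Qed.

Lemma greedy_cvg : (\sum_(0 <= k < n) (greedy k)%:R * d k) @[n --> \oo] --> x.
Proof.
apply/cvgrPdist_lt => e e0.
have /cvgrPdist_lt/(_ _ e0) := r_cvg0; apply: filterS => n.
have /andP[x0 xr] := greedy_remainder n; rewrite sub0r normrN gtr0_norm; last lra.
by move=> re; rewrite gtr0_norm//; lra.
Qed.

End subsum_expansion.

(** * Integral of a truncated affine function *)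

Section hinge.
Variable R : realType.
Implicit Types (a b z : R).
Let mu := @lebesgue_measure R.

(** The region is a right triangle of height [a] and base [a / b]; [a <= b] keeps the base inside
    the unit interval. *)
Lemma integral_hinge a b : 0 < a -> a <= b ->
  (\int[mu]_(z in `]0%R, 1%R]) (Num.max 0 (a - b * z) : R)%:E =
   (a ^+ 2 / (2 * b))%:E)%E.
Proof.
move=> a0 ab; have b0 : 0 < b by exact: lt_le_trans ab.
pose c := a / b.
have c0 : 0 < c by rewrite divr_gt0.
have c1 : c <= 1 by rewrite ler_pdivrMr// mul1r.
have mh D : measurable_fun D (EFin \o (fun z : R => Num.max 0 (a - b * z) : R)).
  apply: measurable_funTS.
  apply/measurable_EFinP; apply: measurable_maxr => //.
  by apply: measurable_funB => //; apply: measurable_funM.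
have -> : [set` `]0, 1]] = `]0, c] `|` `]c, 1] :> set R.
  by rewrite -itv_bndbnd_setU// bnd_simp ltW.
rewrite ge0_integral_setU//; last 3 first.
- exact: mh.
- by move=> z _; rewrite lee_fin le_max lexx.
- rewrite disj_set2E; apply/eqP/seteqP; split=> z //=.
  rewrite !in_itv/= => -[/andP[_ zc] /andP[cz _]].
  by move: (lt_le_trans cz zc); rewrite ltxx.
rewrite [X in (_ + X)%E]integral0_eq ?adde0; last first.
  move=> z; rewrite /= in_itv/= => /andP[cz _]; congr EFin; apply/max_idPl.
  by rewrite subr_le0 mulrC -ler_pdivrMr// ltW.
rewrite integral_itv_obnd_cbnd; last exact: mh.
transitivity (\int[mu]_(z in `[0%R, c]) (a - b * z)%:E)%E.
  apply: eq_integral => z; rewrite inE/= in_itv/= => /andP[_ zc].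
  by congr EFin; apply/max_idPr; rewrite subr_ge0 mulrC -ler_pdivlMr.
have dF z : is_derive z 1 (fun z => a * z - b / 2 * z ^+ 2) (a - b * z).
  by apply: is_derive_eq; rewrite /GRing.scale/=; field.
have cF z : {for z, continuous (fun z => a * z - b / 2 * z ^+ 2)}.
  by apply: differentiable_continuous; apply/derivable1_diffP; apply: ex_derive.
rewrite (@continuous_FTC2 _ _ (fun z => a * z - b / 2 * z ^+ 2))//.
- rewrite -EFinB; congr EFin; rewrite /c; field; lra.
- apply: continuous_subspaceT => z.
  apply: continuousB; first exact: cvg_cst.
  by apply: continuousM; [exact: cvg_cst|exact: cvg_id].
- split.
  + by move=> z _; apply: ex_derive.
  + by apply: cvg_at_right_filter; exact: cF.
  + by apply: cvg_at_left_filter; exact: cF.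
- by move=> z _; rewrite derive1E; apply: derive_val.
Qed.

End hinge.

(** * Termwise integration of [1 - F_ t e] *)

Section partition_integral.
Variables (R : realType) (t : unit_partition R) (e : nat -> bool).
Let a := a_ t.
Let b n := t (n.+1 - e n)%N.
Hypothesis a_le : forall n, a n <= b n.

Let t_gt0 n : 0 < t n. Proof. by have /andP[] := t_itv t n. Qed.

Let b_gt0 n : 0 < b n. Proof. exact: t_gt0. Qed.

Let a_gt0 n : 0 < a n.
Proof. by rewrite subr_gt0 ltNge t_decr ltnn. Qed.

Let sum_a N : \sum_(0 <= n < N) a n = 1 - t N.
Proof.
rewrite -(t_first t) -[RHS]opprB -(telescope_sumr t (leq0n N)) -sumrN.
by apply: eq_bigr => n _; rewrite opprB.
Qed.

Let sum_le_a_cvg (P : pred nat) (c : nat -> R) :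
  (forall n, P n -> 0 <= c n <= a n) ->
  cvgn (fun N => \sum_(0 <= n < N | P n) c n).
Proof.
move=> ca; apply: nondecreasing_is_cvgn.
  by apply: nondecreasing_series => n _ /ca/andP[].
exists 1 => _ [N _ <-]; apply: (@le_trans _ _ (\sum_(0 <= n < N) a n)).
  rewrite big_mkcond/=; apply: ler_sum => n _.
  by case: ifPn => [/ca/andP[]//|_]; exact: ltW.
by rewrite sum_a gerBl ltW.
Qed.

(** As the [a n] sum to 1, index [n] contributes [a n - a n] or [a n - b n * z], depending on the
    side of [a n / b n] on which [z] lies. *)
Lemma one_sub_F_series z : 0 < z ->
  (\sum_(0 <= n < N) (Num.max 0 (a n - b n * z) : R)) @[N --> \oo] --> 1 - F_ t e z.
Proof.
move=> z0.
have cA : cvgn (fun N => \sum_(0 <= n < N | a n / b n < z) a n).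
  by apply: sum_le_a_cvg => n _; rewrite lexx ltW.
have cB : cvgn (fun N => \sum_(0 <= n < N | z <= a n / b n) b n * z).
  apply: sum_le_a_cvg => n zab.
  by rewrite mulr_ge0 ?(ltW z0) ?(ltW (b_gt0 n))//= mulrC -ler_pdivlMr.
have c1 : (1 - t N) @[N --> \oo] --> (1 : R).
  have := cvgB (cvg_cst (1 : R)) (@t_cvg0 _ t); rewrite subr0; exact.
suff -> : (fun N => \sum_(0 <= n < N) (Num.max 0 (a n - b n * z) : R)) =
    (fun N => 1 - t N - (\sum_(0 <= n < N | a n / b n < z) a n
                       + \sum_(0 <= n < N | z <= a n / b n) b n * z)).
  exact: cvgB c1 (cvgD cA cB).
apply/funext => N; rewrite -sum_a.
rewrite [X in _ - (X + _)]big_mkcond [X in _ - (_ + X)]big_mkcond -big_split -sumrB.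
apply: eq_bigr => n _ /=; rewrite ltNge.
have [zab|abz] := leP z (a n / b n) => /=.
  by rewrite add0r max_r// subr_ge0 mulrC -ler_pdivlMr.
by rewrite addr0 subrr max_l// subr_le0 mulrC -ler_pdivrMr// ltW.
Qed.

Let c n := a n ^+ 2 / (2 * b n).

Let c_itv n : 0 <= c n <= a n.
Proof.
have := a_gt0 n; have := b_gt0 n; have := a_le n => ab b0 a0.
rewrite /c divr_ge0 ?sqr_ge0 ?mulr_ge0 ?(ltW b0)//= ler_pdivrMr ?mulr_gt0//.
by rewrite expr2 ler_wpM2l ?(ltW a0)//; lra.
Qed.

Lemma M_series : (\sum_(0 <= n < N) c n) @[N --> \oo] --> M_ t e.
Proof.
have cc : cvgn (fun N => \sum_(0 <= n < N) c n).
  by apply: sum_le_a_cvg => n _; exact: c_itv.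
suff -> : M_ t e = limn (fun N => \sum_(0 <= n < N) c n) by [].
rewrite /M_ /Rintegral.
(* In the extended reals, sum and integral commute because the terms are measurable and
   nonnegative. *)
transitivity (fine (\int[@lebesgue_measure R]_(z in `]0%R, 1%R])
    \sum_(0 <= n <oo) (Num.max 0 (a n - b n * z) : R)%:E)%E).
  congr fine; apply: eq_integral => z; rewrite inE/= in_itv/= => /andP[z0 _].
  have h := one_sub_F_series _ z0.
  rewrite -(cvg_lim _ h)// -EFin_lim; last by apply/cvg_ex; eexists; exact: h.
  by congr (limn _); apply/funext => N /=; rewrite sumEFin.
rewrite integral_nneseries//; last 2 first.
- move=> n; apply: measurable_funTS; apply/measurable_EFinP.
  apply: measurable_maxr => //.
  by apply: measurable_funB => //; apply: measurable_funM.
- by move=> n z _; rewrite lee_fin le_max lexx.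
under eq_eseriesr do rewrite integral_hinge//.
rewrite (_ : (fun N => _) = EFin \o (fun N => \sum_(0 <= n < N) c n)).
  by rewrite EFin_lim.
by apply/funext => N /=; rewrite sumEFin.
Qed.

End partition_integral.

(** * Gaps and tails of the Luroth series *)

Lemma telescope_le_tail (R : realType) (u g : nat -> R) (L : R) n :
  (\sum_(0 <= k < N) u k) @[N --> \oo] --> L -> g @ \oo --> 0 ->
  (forall k, (n <= k)%N -> g k - g k.+1 <= u k) ->
  g n <= L - \sum_(0 <= k < n) u k.
Proof.
move=> uL g0 gu; rewrite lerBrDl.
apply: (@ler_cvg_to _ _ _ _ (fun N => \sum_(0 <= k < n) u k + g n - g N)) uL _.
  by have := cvgB (cvg_cst (\sum_(0 <= k < n) u k + g n)) g0; rewrite subr0; exact.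
exists n => // N /= nN; rewrite (big_cat_nat (leq0n n) nN)//= -addrA lerD2l.
rewrite -opprB -(telescope_sumr g nN) -sumrN.
by apply: ler_sum_nat => k /andP[nk _]; rewrite opprB gu.
Qed.

Section luroth_gaps.
Variable R : realType.

(** This is the square of [a_ (luroth R) n]. Reciprocals of consecutive [t n] differ by 1, so
    turning digit [n] from 1 to 0 raises [M_] by half of it. *)
Definition luroth_gap (n : nat) : R := (n.+1%:R * n.+2%:R) ^- 2.
Local Notation d := luroth_gap.

Lemma luroth_gap_gt0 n : 0 < d n.
Proof. by rewrite invr_gt0 exprn_gt0// mulr_gt0 ?ltr0n. Qed.

Let K : R := M_ (luroth R) (fun=> true).

Lemma luroth_M_series (e : nat -> bool) :
  (\sum_(0 <= n < N) (~~ e n)%:R * d n) @[N --> \oo] --> 2 * (M_ (luroth R) e - K).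
Proof.
have aE n : a_ (luroth R) n = (n.+1%:R * n.+2%:R)^-1 :> R.
  have n0 := ler0n R n.
  by rewrite /a_/= /luroth_seq -(natr1 n.+1) -(natr1 n); field; lra.
have ab (e' : nat -> bool) n : a_ (luroth R) n <= luroth R (n.+1 - e' n)%N.
  rewrite aE /= /luroth_seq lef_pV2 ?posrE ?mulr_gt0 ?ltr0n//.
  rewrite -natrM ler_nat; case: (e' n); rewrite [nat_of_bool _]/= ?subn1 ?subn0.
  - exact: (@leq_pmulr n.+1).
  - exact: (@leq_pmull n.+2).
suff -> : (fun N => \sum_(0 <= n < N) (~~ e n)%:R * d n) =
    (fun N => 2 * (\sum_(0 <= n < N) a_ (luroth R) n ^+ 2
                      / (2 * luroth R (n.+1 - e n)%N)
                 - \sum_(0 <= n < N) a_ (luroth R) n ^+ 2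
                      / (2 * luroth R (n.+1 - true)%N))).
  apply: cvgMl_tmp; apply: cvgB; first exact: M_series (ab e).
  exact: M_series (ab (fun=> true)).
apply/funext => N; rewrite -sumrB mulr_sumr; apply: eq_bigr => n _.
rewrite aE /d /= /luroth_seq subn1 /=; have n0 := ler0n R n.
case: (e n); rewrite ?subn1 ?subn0/=; first by rewrite subrr mul0r mulr0.
by rewrite -(natr1 n.+1) -(natr1 n); field; lra.
Qed.

(** The first term is the full sum of the gaps, by [luroth_M_series] at the zero sequence; hence
    this is the sum of [d k] over [k >= n]. *)
Definition luroth_tail (n : nat) : R :=
  2 * (M_ (luroth R) (fun=> false) - K) - \sum_(0 <= k < n) d k.
Local Notation r := luroth_tail.

Lemma luroth_gap_cvg :
  (\sum_(0 <= k < N) d k) @[N --> \oo] --> 2 * (M_ (luroth R) (fun=> false) - K).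
Proof.
have := luroth_M_series (fun=> false).
by under eq_fun do under eq_bigr do rewrite mul1r.
Qed.

Lemma luroth_tail_rec n : r n = d n + r n.+1.
Proof. by rewrite /r big_nat_recr//=; ring. Qed.

Lemma luroth_tail_cvg0 : r @ \oo --> 0.
Proof.
have := cvgB (cvg_cst (2 * (M_ (luroth R) (fun=> false) - K))) luroth_gap_cvg.
by rewrite subrr; exact.
Qed.

Let cvg0_le_harmonic (g : nat -> R) :
  (forall n, 0 <= g n <= n.+1%:R^-1) -> g @ \oo --> 0.
Proof.
move=> gn; apply: (squeeze_cvgr _ (cvg_cst 0) (@cvg_harmonic R)).
by near=> n; exact: gn.
Unshelve. all: by end_near. Qed.

(** A telescoping lower bound sharp enough for [d 3 = 1/400 < lo 4 = 1/390]. *)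
Let lo (n : nat) : R := (3 * n.+1%:R * (n.+1%:R ^+ 2 + 1))^-1.

Lemma luroth_tail_ge n : lo n <= r n.
Proof.
apply: telescope_le_tail => [||k _]; first exact: luroth_gap_cvg.
- apply: cvg0_le_harmonic => k; have k0 : 0 < k.+1%:R :> R by rewrite ltr0n.
  have p0 : 0 <= k.+1%:R ^+ 2 :> R by rewrite sqr_ge0.
  rewrite invr_ge0 mulr_ge0 ?mulr_ge0 ?(ltW k0)//= ?addr_ge0//.
  by rewrite lef_pV2 ?posrE ?mulr_gt0//; nra.
- have k0 := ler0n R k; rewrite -subr_ge0 /d /lo -(natr1 k.+1) -(natr1 k).
  set x := k%:R.
  (* Over a common denominator, the excess of [d k] over [lo k - lo k.+1] has only positive
     coefficients. *)
  rewrite (_ : _ - _ = (4 * (x + 1) * (x + 2) + 6) / (3 * ((x + 1) * (x + 2)) ^+ 2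
     * ((x + 1) ^+ 2 + 1) * ((x + 2) ^+ 2 + 1))); last first.
    by field; rewrite -/x in k0 *; apply/and4P; split; nra.
  by rewrite -/x in k0 *; rewrite divr_ge0// ?mulr_ge0//; nra.
Qed.

Lemma luroth_tail3_le : r 3 <= 180^-1.
Proof.
(* For [k > 0], [hi k - hi k.+1] is [1 / (k (k+1) (k+2) (k+3))], which exceeds [d k] because
   [k (k+3) = (k+1) (k+2) - 2]. *)
pose hi (n : nat) : R := (3 * n%:R * n.+1%:R * n.+2%:R)^-1.
have -> : 180^-1 = hi 3 by rewrite /hi -!natrM.
have hi0 : hi @ \oo --> 0.
  (* At index 0 the denominator vanishes and [hi 0 = 0] by convention. *)
  apply: cvg0_le_harmonic => -[|k].
    by rewrite /hi mulr0 !mul0r invr0 lexx invr_ge0 ler0n.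
  have k0 := ler0n R k; rewrite /hi -(natr1 k.+2) -(natr1 k.+1) -(natr1 k).
  rewrite invr_ge0 !mulr_ge0 ?addr_ge0//=.
  by rewrite lef_pV2 ?posrE; nra.
(* Negating both sequences turns the lower bound on tails into an upper bound. *)
have := @telescope_le_tail _ (fun k => - d k) (fun k => - hi k)
  (- (2 * (M_ (luroth R) (fun=> false) - K))) 3.
rewrite sumrN -opprD lerN2 => H; apply: H => [||k k3].
- under eq_fun do rewrite sumrN.
  by apply: cvgN; exact: luroth_gap_cvg.
- by rewrite -oppr0; apply: cvgN.
- have k0 : 3 <= k%:R :> R by rewrite ler_nat.
  rewrite -opprD lerN2 -subr_ge0 /d /hi -(natr1 k.+2) -(natr1 k.+1) -(natr1 k).
  set x := k%:R in k0 *.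
  rewrite (_ : _ - _ = 2 / (x * (x + 3) * ((x + 1) * (x + 2)) ^+ 2)); last first.
    by field; apply/and4P; split; lra.
  by rewrite divr_ge0// !mulr_ge0 ?sqr_ge0//; lra.
Qed.

Lemma luroth_gap_lt_tail n : (3 <= n)%N -> d n < r n.+1.
Proof.
move=> /subnK <-; set k := (n - 3)%N.
apply: lt_le_trans (luroth_tail_ge _); rewrite /d /lo.
have k0 := ler0n R k; rewrite -(natr1 (k + 3).+1) -(natr1 (k + 3)) natrD.
set x := k%:R in k0 *.
by rewrite ltf_pV2 ?posrE ?mulr_gt0 ?exprn_gt0 ?mulr_gt0//; nra.
Qed.

(** At 5 the bound gives [1/1764 < 1/1560]; at 4 it fails, [lo 6 = 1/1050] being below
    [d 4 = 1/900]. *)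
Lemma luroth_gap_lt_tail2 n : (5 <= n)%N -> d n < r n.+2.
Proof.
move=> /subnK <-; set k := (n - 5)%N.
apply: lt_le_trans (luroth_tail_ge _); rewrite /d /lo.
have k0 := ler0n R k.
rewrite -(natr1 (k + 5).+2) -(natr1 (k + 5).+1) -(natr1 (k + 5)) natrD.
set x := k%:R in k0 *.
by rewrite ltf_pV2 ?posrE ?mulr_gt0 ?exprn_gt0 ?mulr_gt0//; nra.
Qed.

(** Indices are shifted by 3 because [d 2 = 1/144] exceeds [r 3]. *)
Lemma luroth_subsum_interior (E : nat -> nat -> bool) (x : R) : 0 < x < r 3 ->
  exists2 e : nat -> bool, (forall i, e <> E i) &
    (\sum_(0 <= k < n) (e k)%:R * d (k + 3)%N) @[n --> \oo] --> x.
Proof.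
move=> xr; pose d' k := d (k + 3)%N; pose r' k := r (k + 3)%N.
have d0 n : 0 < d' n by exact: luroth_gap_gt0.
have rS n : r' n = d' n + r' n.+1 by exact: luroth_tail_rec.
have dr n : d' n < r' n.+1 by rewrite luroth_gap_lt_tail// leq_addl.
have dr2 : \forall n \near \oo, d' n < r' n.+2.
  by exists 2%N => // n /= n2; rewrite luroth_gap_lt_tail2// (leq_add n2).
have r0 : r' @ \oo --> 0 by rewrite /r' cvg_shiftn; exact: luroth_tail_cvg0.
exists (greedy _ d' r' E x); first exact: (greedy_neq _ d' r').
exact: (greedy_cvg _ d' r').
Qed.

End luroth_gaps.

(** * The eight intervals *)

Section luroth_Mset.
Variable R : realType.
Local Notation d := (luroth_gap R).
Local Notation r := (luroth_tail R).
Let K : R := M_ (luroth R) (fun=> true).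

(** Binary digits, most significant first; only [k < 3] matters. *)
Definition digit (i : 'I_8) (k : nat) : bool := odd (i %/ 2 ^ (2 - k)).

(** The first three gaps are 36, 4 and 1 in units of 1/144. *)
Definition weight (i : 'I_8) : nat :=
  (36 * digit i 0 + 4 * digit i 1 + digit i 2)%N.

Definition luroth_left (i : 'I_8) : R := K + (weight i)%:R / 288.
Definition luroth_length : R := r 3 / 2.
Local Notation c := luroth_left.
Local Notation l := luroth_length.

Lemma digits_surj (b : nat -> bool) :
  exists i : 'I_8, forall k, (k < 3)%N -> digit i k = b k.
Proof.
exists (inord (4 * b 0 + 2 * b 1 + b 2)%N).
by case=> [|[|[|k]]] // _; rewrite /digit inordK;
  case: (b 0); case: (b 1); case: (b 2).
Qed.

Lemma weight_lt (i j : 'I_8) : (i < j)%N -> (weight i < weight j)%N.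
Proof.
(* [w] is [weight] on plain naturals, so that all pairs below 8 are checked by computation. *)
pose w m := (36 * odd (m %/ 4) + 4 * odd (m %/ 2) + odd (m %/ 1))%N.
have /allP/(_ i) : all (fun m => all (fun n => (m < n)%N ==> (w m < w n)%N) (iota 0 8))
  (iota 0 8) by [].
rewrite mem_iota ltn_ord => /(_ isT)/allP/(_ j).
by rewrite mem_iota ltn_ord => /(_ isT)/implyP.
Qed.

Lemma sum3_gap (i : 'I_8) :
  \sum_(0 <= k < 3) (digit i k)%:R * d k = (weight i)%:R / 144.
Proof.
by rewrite /weight 2!natrD !natrM !big_nat_recr ?big_geq//= /luroth_gap; field.
Qed.

Lemma M_luroth_series_eq (e : nat -> bool) (x : R) :
  (\sum_(0 <= n < N) (~~ e n)%:R * d n) @[N --> \oo] --> x ->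
  M_ (luroth R) e = K + x / 2.
Proof.
move=> ex; have := cvg_unique _ ex (luroth_M_series R e); rewrite -/K => ->//.
by field.
Qed.

Lemma sum_shift3 (u : nat -> R) n :
  \sum_(0 <= k < n + 3) u k =
  \sum_(0 <= k < 3) u k + \sum_(0 <= k < n) u (k + 3)%N.
Proof.
rewrite (big_cat_nat (leq0n 3) (leq_addl n 3))/=; congr (_ + _).
by rewrite -{1}(add0n 3%N) big_addn addnK.
Qed.

(** Subsum digits select gaps, whereas a gap counts in [M_] when the digit is 0; hence the
    negation. *)
Definition prepend (i : 'I_8) (e : nat -> bool) (k : nat) : bool :=
  ~~ (if (k < 3)%N then digit i k else e (k - 3)%N).

Lemma M_luroth_prepend (i : 'I_8) (e : nat -> bool) (x : R) :
  (\sum_(0 <= k < n) (e k)%:R * d (k + 3)%N) @[n --> \oo] --> x ->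
  M_ (luroth R) (prepend i e) = c i + x / 2.
Proof.
move=> ex.
rewrite (@M_luroth_series_eq _ ((weight i)%:R / 144 + x)).
  by rewrite /luroth_left; field.
rewrite -(cvg_shiftn 3) -sum3_gap.
suff -> : (fun n => \sum_(0 <= k < n + 3) (~~ prepend i e k)%:R * d k) =
   (fun n => \sum_(0 <= k < 3) (digit i k)%:R * d k
             + \sum_(0 <= k < n) (e k)%:R * d (k + 3)%N).
  by apply: cvgD => //; exact: cvg_cst.
apply/funext => n; rewrite sum_shift3; congr (_ + _); apply: eq_big_nat => k kn.
  by rewrite /prepend negbK; move: kn => /= ->.
by rewrite /prepend negbK ltnNge leq_addl/= addnK.
Qed.

Let shift_gap_cvg : (\sum_(0 <= k < n) d (k + 3)%N) @[n --> \oo] --> r 3.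
Proof.
suff -> : (fun n => \sum_(0 <= k < n) d (k + 3)%N) =
    (fun n => \sum_(0 <= k < n + 3) d k - \sum_(0 <= k < 3) d k).
  apply: cvgB; last exact: cvg_cst.
  by have := luroth_gap_cvg R; rewrite -(cvg_shiftn 3).
by apply/funext => n; rewrite sum_shift3 addrC addKr.
Qed.

Lemma luroth_tail3_gt0 : 0 < r 3.
Proof.
rewrite luroth_tail_rec addr_gt0 ?luroth_gap_gt0//.
exact: lt_trans (luroth_gap_gt0 R 3) (luroth_gap_lt_tail R 3 _).
Qed.

(** The first three complemented digits select [i]; the remaining subsum lies between 0 and
    [r 3]. *)
Lemma M_luroth_itv (e : nat -> bool) :
  exists i : 'I_8, c i <= M_ (luroth R) e <= c i + l.
Proof.
have [i di] := digits_surj (negb \o e); exists i.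
pose u n := \sum_(0 <= k < n) (~~ e (k + 3)%N)%:R * d (k + 3)%N.
have ule n : u n <= \sum_(0 <= k < n) d (k + 3)%N.
  apply: ler_sum => k _; have := luroth_gap_gt0 R (k + 3).
  by case: (e _) => /=; rewrite ?mul0r ?mul1r// => /ltW.
have u_cvg : u @ \oo --> 2 * (M_ (luroth R) e - K) - (weight i)%:R / 144.
  suff -> : u = (fun n => \sum_(0 <= k < n + 3) (~~ e k)%:R * d k
                 - (weight i)%:R / 144).
    apply: cvgB; last exact: cvg_cst.
    by have := luroth_M_series R e; rewrite -(cvg_shiftn 3).
  apply/funext => n; rewrite sum_shift3 -sum3_gap.
  rewrite [X in _ = X + _ - _]
    (eq_big_nat _ _ (F2 := fun k => (digit i k)%:R * d k)).
    by rewrite addrC addKr.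
  by move=> k k3; rewrite di.
have u0 : 0 <= 2 * (M_ (luroth R) e - K) - (weight i)%:R / 144.
  apply: ler_cvg_to (cvg_cst 0) u_cvg _; near=> n.
  by apply: sumr_ge0 => k _; rewrite mulr_ge0// ltW// luroth_gap_gt0.
have ur : 2 * (M_ (luroth R) e - K) - (weight i)%:R / 144 <= r 3.
  by apply: ler_cvg_to u_cvg shift_gap_cvg _; near=> n; exact: ule.
by rewrite /luroth_left /luroth_length; apply/andP; split; lra.
Unshelve. all: by end_near. Qed.

Lemma Mset_luroth : Mset (luroth R) = \bigcup_(i : 'I_8) [set` `[c i, c i + l]].
Proof.
apply/seteqP; split=> [_ [e _ <-]|M [i _]].
  by have [i iM] := M_luroth_itv e; exists i => //=; rewrite in_itv.
rewrite /= in_itv/= /luroth_length => iM; pose x := 2 * (M - c i).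
suff [e ex] : exists e : nat -> bool,
    (\sum_(0 <= k < n) (e k)%:R * d (k + 3)%N) @[n --> \oo] --> x.
  by exists (prepend i e) => //; rewrite (M_luroth_prepend _ _ _ ex) /x; field.
(* The greedy expansion needs an interior point; the endpoints are the empty and the full subsum. *)
have : 0 <= x <= r 3 by rewrite /x; apply/andP; split; lra.
rewrite !le_eqVlt => /andP[/predU1P[<-|x0] /predU1P[|xr]].
- by move=> r0; have := luroth_tail3_gt0; rewrite -r0 ltxx.
- exists (fun=> false).
  under eq_fun do (under eq_bigr do rewrite mul0r; rewrite big1_eq).
  exact: cvg_cst.
- move=> ->; exists (fun=> true).
  by under eq_fun do under eq_bigr do rewrite mul1r.
- have [|e _ ex] := @luroth_subsum_interior R (fun _ _ => false) x; last by exists e.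
  by rewrite x0.
Qed.

(* 1/1440 = 1/288 - 1/360 *)
Lemma luroth_left_lt (i j : 'I_8) : (i < j)%N -> c i + l + 1 / 1440 <= c j.
Proof.
move=> ij; rewrite /luroth_left /luroth_length; have := luroth_tail3_le R.
have : (weight i)%:R + 1 <= (weight j)%:R :> R by rewrite natr1 ler_nat weight_lt.
lra.
Qed.

Lemma interior_Mset_luroth (M : R) : interior (Mset (luroth R)) M ->
  exists i : 'I_8, c i < M < c i + l.
Proof.
move=> /nbhs_ballP[eps /= e0 Me].
have Mitv x : `|M - x| < eps -> exists i : 'I_8, c i <= x <= c i + l.
  by move=> /Me; rewrite Mset_luroth => -[i _]; rewrite /= in_itv; exists i.
have [i /andP[iM Mi]] : exists i : 'I_8, c i <= M <= c i + l.
  by apply: Mitv; rewrite subrr normr0.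
(* A step [h] past an endpoint stays within the [eps]-ball but is shorter than the gaps between
   intervals, which are at least 1/1440. *)
pose h := Num.min (eps / 2) 2880^-1.
have [h0 [he h1]] : 0 < h /\ h < eps /\ h < 1440^-1.
  by rewrite /h lt_min; have [] := leP (eps / 2) 2880^-1; repeat split; lra.
exists i; rewrite !lt_neqAle iM Mi !andbT; apply/andP; split; apply/eqP => eqM.
- have [|j /andP[jM Mj]] := Mitv (M - h); first by rewrite subKr gtr0_norm.
  have [ij|ji|/val_inj ij] := ltngtP i j.
  + have := luroth_left_lt _ _ ij; lra.
  + have := luroth_left_lt _ _ ji; lra.
  + by move: jM; rewrite -ij; lra.
- have [|j /andP[jM Mj]] := Mitv (M + h).
    by rewrite opprD addrA subrr sub0r normrN gtr0_norm.
  have [ij|ji|/val_inj ij] := ltngtP i j.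
  + have := luroth_left_lt _ _ ij; lra.
  + have := luroth_left_lt _ _ ji; lra.
  + by move: Mj; rewrite -ij; lra.
Qed.

End luroth_Mset.

Theorem theorem1p4 (R : realType) :
  (exists (c : 'I_8 -> R) (l : R),
     [/\ 0 < l,
         trivIset [set: 'I_8] (fun i => [set` `[c i, c i + l]]) &
         Mset (luroth R) = \bigcup_(i : 'I_8) [set` `[c i, c i + l]] ])
  /\ (forall M : R, interior (Mset (luroth R)) M ->
        ~ countable [set e : nat -> bool | M_ (luroth R) e = M]).
Proof.
split.
  exists (luroth_left R), (luroth_length R); split; last exact: Mset_luroth.
    by rewrite divr_gt0// luroth_tail3_gt0.
  move=> i j _ _ [x [/=]]; rewrite !in_itv/= => /andP[ix xi] /andP[jx xj].
  have [ij|ji|/val_inj//] := ltngtP i j.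
    by exfalso; have := luroth_left_lt R _ _ ij; lra.
  by exfalso; have := luroth_left_lt R _ _ ji; lra.
move=> M /interior_Mset_luroth[i iM] /countable_injP[g g_inj].
pose S := [set e : nat -> bool | M_ (luroth R) e = M].
pose E n k := ~~ xget (fun=> false) [set e | S e /\ g e = n] (k + 3)%N.
pose x := 2 * (M - luroth_left R i).
have [|e eE ex] := @luroth_subsum_interior R E x.
  by move: iM; rewrite /x /luroth_length => /andP[? ?]; apply/andP; split; lra.
have Se : S (prepend i e).
  by rewrite /S/= (M_luroth_prepend _ _ _ _ ex) /x; field.
(* The new element has a code of its own; by injectivity [E] at that code returns [e], which was
   chosen to avoid it. *)
apply: (eE (g (prepend i e))); apply/funext => k; rewrite /E.
case: xgetP => [e' _ [Se' ge']|/(_ (prepend i e))[]//].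
rewrite (g_inj _ _ _ _ ge') ?inE// /prepend ltnNge leq_addl/= negbK addnK//.
Qed.
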